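(* Let $a,b,a',b'>0$, and let $X\sim\mathrm{Beta}(a,b)$ and $Y\sim\mathrm{Beta}(a',b')$. Then $X\le_c Y$ if and only if $a\ge a'$ and $b\le b'$.
   Context: For $a,b>0$, $\mathrm{Beta}(a,b)$ is the distribution on $[0,1]$ with density $x^{a-1}(1-x)^{b-1}/\mathrm{B}(a,b)$ for $x\in(0,1)$, where $\mathrm{B}(a,b)=\int_0^1 y^{a-1}(1-y)^{b-1}\,dy$. Its distribution function is a strictly increasing continuous bijection $[0,1]\to[0,1]$. Convex transform order $\le_c$: if $X$ and $Y$ have distributions supported by intervals $I$ and $J$ with strictly increasing distribution functions $F\colon I\to[0,1]$ and $G\colon J\to[0,1]$, then $X\le_c Y$ means that the mapping $x\mapsto G^{-1}(F(x))$ is convex on $I$. For Beta distributions $I=J=[0,1]$. *)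

(* Defs.v *)
(* MathComp-Analysis, over an arbitrary realType R. *)
From HB Require Import structures.
From mathcomp Require Import all_boot all_order all_algebra.
From mathcomp Require Import all_classical all_reals all_analysis.

Set Implicit Arguments.
Unset Strict Implicit.
Unset Printing Implicit Defensive.

Import Order.TTheory GRing.Theory Num.Theory.
Import numFieldNormedType.Exports.

Local Open Scope classical_set_scope.
Local Open Scope ring_scope.

(* The library's beta_fun, beta_pdf and beta_prob only take parameters in nat,
   hence the versions below with parameters a, b in R. All integrands are
   restricted to the open interval `]0, 1[, where the powers are genuine real
   powers (powR is total, with conventional values for bases <= 0). *)
Definition beta_kernel (R : realType) (a b x : R) : R :=
  x `^ (a - 1) * (1 - x) `^ (b - 1).

Definition beta_integral (R : realType) (a b : R) : R :=
  \int[lebesgue_measure]_(y in `]0, 1[) beta_kernel a b y.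

Definition beta_density (R : realType) (a b : R) : R -> R :=
  (fun x => beta_kernel a b x / beta_integral a b) \_ `]0, 1[.

Definition beta_distributed d (T : measurableType d) (R : realType)
    (P : probability T R) (X : {RV P >-> R}) (a b : R) : Prop :=
  forall A : set R, measurable A ->
    distribution P X A =
    (\int[lebesgue_measure]_(x in A) (beta_density a b x)%:E)%E.

(* The library's cdf, with values in R instead of \bar R. *)
Definition df d (T : measurableType d) (R : realType)
    (P : probability T R) (X : {RV P >-> R}) (x : R) : R := fine (cdf X x).

Definition supported_increasing d (T : measurableType d) (R : realType)
    (P : probability T R) (X : {RV P >-> R}) (I : interval R) : Prop :=
  P (X @^-1` [set` I]) = 1%E /\ {in I &, {homo df X : x y / x < y}}.

(* Convex transform order of X and Y relative to supporting intervals I and J.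
   The first three clauses are the conditions under which the order is
   considered, the third one stating that G^-1 (F x) makes sense for x in I;
   G^-1 is pinv [set` J] G, the inverse of G on J, since G is injective on J. *)
Definition convex_transform_le (R : realType)
    d (T : measurableType d) (P : probability T R) (X : {RV P >-> R})
    d' (T' : measurableType d') (Q : probability T' R) (Y : {RV Q >-> R})
    (I J : interval R) : Prop :=
  let F := df X in let G := df Y in
  [/\ supported_increasing X I, supported_increasing Y J,
      F @` [set` I] `<=` G @` [set` J] &
      convex_function [set` I] (fun x : R => pinv [set` J] G (F x))].

(* Main.v *)
(** Let F and G be the distribution functions of X and Y, let y = G^-1 o F, and
    put xb = 1 - x, yb = 1 - y and q = x xb F'(x) / (y yb G'(y)). In terms of
    d/ds = x xb d/dx the density formulas become y_s = y yb q and q_s = q tau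
    with tau = a xb - b x - (a' yb - b' y) q, and x xb y''/y' equals
    E = tau + (q yb - xb) + (x - q y). Since x F'(x) / F(x) tends to a at 0
    and (1 - x) F'(x) / (1 - F(x)) tends to b at 1, q tends to a/a' at 0 and to
    b/b' at 1.
    If y is convex, its tangents lie below the points (0, 0) and (1, 1), that is
    q yb >= xb and q y <= x, and the limits at 0 and 1 give a >= a' and b <= b'.
    Conversely, if a >= a' and b <= b', then F'/G' is nondecreasing, so y <= x,
    and a minimum principle applies successively to yb - xb / q, x - q y and E,
    which are nonnegative at both ends: at a negative interior minimum the
    first derivative vanishes, and eliminating a' and b between that equation
    and the definition of tau leaves a second derivative that is manifestly
    negative. *)
Require Import Defs.
From mathcomp Require Import all_boot all_order all_algebra.
From mathcomp Require Import all_classical all_reals all_analysis.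
From mathcomp Require Import measurable_realfun ring lra.

Set Implicit Arguments.
Unset Strict Implicit.
Unset Printing Implicit Defensive.

Import Order.TTheory GRing.Theory Num.Theory.
Import numFieldNormedType.Exports.

Local Open Scope classical_set_scope.
Local Open Scope ring_scope.

(** * Polynomial certificates *)

Ltac positivity :=
  repeat match goal with
  | |- is_true (0 <= _ + _) => apply: addr_ge0
  | |- is_true (0 <= _ * _) => apply: mulr_ge0
  | |- is_true (0 <= _ ^+ _) => apply: exprn_ge0
  | |- is_true (0 < _ + _) => apply: addr_gt0
  | |- is_true (0 < _ * _) => apply: mulr_gt0
  | |- is_true (0 < _ ^+ _) => apply: exprn_gt0
  | |- is_true (0 < _^-1) => rewrite invr_gt0
  | _ => first [exact: ler0n | exact: ltr0n | assumption
               | apply: ltW; assumption]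
  end.

(* Here z = q yb, w = q y, dl = a - a' and dl' = b' - b; Ds, Ps, Ns and taus are
   the derivatives of D, z - xb, x - w and tau with respect to s. *)
Section certificates.
Variables (R : realFieldType) (a' b dl dl' x xb z w tau : R).
Hypotheses (dl_ge0 : 0 <= dl) (dl'_ge0 : 0 <= dl').
Hypotheses (xb_gt0 : 0 < xb) (w_gt0 : 0 < w).

Let D := x * xb - z * w.
Let Ds := x * xb * (xb - x) - z * w * (2 * tau + z - w).
Let Ps := D + z * tau.
Let Ns := D - w * tau.
Let taus := - a' * Ps - b * Ns - dl * (x * xb) + dl' * (w * (z + tau)).

Hypothesis tauE : tau = - a' * (z - xb) - b * (x - w) + dl * xb + dl' * w.

(** Up to the positive factor 1/q, [D + xb * tau] is the s-derivative of yb - xb/q, which has the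
    sign of z - xb. The conclusion bounds the s-derivative of [D + xb * tau] at a critical point
    where that function is negative. *)
Lemma starshaped_left_certificate : 0 <= a' -> 0 < z -> z < xb -> w < x ->
  D + xb * tau = 0 -> Ds - x * xb * tau + xb * taus < 0.
Proof.
move=> a'_ge0 z_gt0 zxb wx V0.
pose f := xb - z; pose N := x - w.
have f_gt0 : 0 < f by rewrite subr_gt0.
have N_gt0 : 0 < N by rewrite subr_gt0.
have x_gt0 : 0 < x by apply: lt_trans wx.
have DE : D = xb * N + w * f by rewrite /D /N /f; ring.
have D_gt0 : 0 < D by rewrite DE addr_gt0 ?mulr_gt0.
have xbN0 : xb != 0 by rewrite gt_eqF.
have tau_def : tau = - (D / xb).
  by apply: (mulfI xbN0); rewrite mulrN mulrCA mulfV// mulr1; lra.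
rewrite -(pmulr_rlt0 _ N_gt0).
set U := _ + xb * taus.
have -> : N * U = - (a' * (D * f * (N + xb + w))
    + dl * (x * xb ^+ 2 * N + xb * D * (xb + w))
    + dl' * (w * (D * (N + w) + xb * (N * f + f * w)))
    + w * f / xb * (xb * N ^+ 2 + x * xb * f + w * f * (x + N))).
  (* This multiple of [tauE] is chosen so that b cancels; then a', [dl] and [dl'] are left with
     coefficients of a definite sign. *)
  transitivity (N * U - xb * Ns *
      (- a' * (z - xb) - b * (x - w) + dl * xb + dl' * w - tau)).
    by rewrite -tauE subrr mulr0 subr0.
  by rewrite /U /taus /Ds /Ps /Ns tau_def /D /f /N; field.
rewrite oppr_lt0 ltr_wpDl//; first by positivity.
rewrite !(mulr_gt0, invr_gt0)// ltr_pwDr//; last by positivity.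
by rewrite !mulr_gt0// addr_gt0.
Qed.

(** The same scheme for x - w, whose s-derivative is [D - w * tau]. Here [D] equals [- G], and the
    equation for [tau] serves to eliminate a' instead of b. *)
Lemma starshaped_right_certificate : 0 <= b -> 0 < x -> x < w -> xb < z ->
  D - w * tau = 0 -> Ds - w * (tau * (tau + z) + taus) < 0.
Proof.
move=> b_ge0 x_gt0 xw xbz V0.
pose f := w - x; pose P := z - xb; pose G := xb * f + w * P.
have f_gt0 : 0 < f by rewrite subr_gt0.
have P_gt0 : 0 < P by rewrite subr_gt0.
have z_gt0 : 0 < z by apply: lt_trans xbz.
have G_gt0 : 0 < G by rewrite addr_gt0 ?mulr_gt0.
have wN0 : w != 0 by rewrite gt_eqF.
have tau_def : tau = - (G / w).
  apply: (mulfI wN0); rewrite mulrN mulrCA mulfV// mulr1.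
  by move: V0; rewrite /D /G /f /P; lra.
rewrite -(pmulr_rlt0 _ P_gt0).
set U := _ - w * _.
have -> : P * U = - (b * (f * G * (w + z))
    + dl * (xb * (w * P * f + xb * f * (w + z) + w * P * z))
    + dl' * (w * (w * P * z + G * (w + xb)))
    + xb * f / w * (w * P ^+ 2 + z * w * f + xb * f * (z + P))).
  transitivity (P * U + w * Ps *
      (- a' * (z - xb) - b * (x - w) + dl * xb + dl' * w - tau)).
    by rewrite -tauE subrr mulr0 addr0.
  by rewrite /U /taus /Ds /Ps /Ns tau_def /G /D /f /P; field.
rewrite oppr_lt0 ltr_wpDl//; first by positivity.
by positivity.
Qed.

Let e := tau + (z - xb) + (x - w).
Let V := taus + Ps + Ns.
(** Second s-derivatives of z - xb and x - w, with [t] in place of the derivative of [tau]. Where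
    [V] vanishes, [t] can be replaced by [- (Ps + Ns)], which does not involve a' or b. *)
Let Pss t := Ds + z * (tau * (tau - w) + t).
Let Nss t := Ds - w * (tau * (tau + z) + t).
Let U t := (1 - a') * Pss t + (1 - b) * Nss t - dl * (x * xb * (xb - x))
    + dl' * (w * ((z + tau) ^+ 2 + z * (tau - w) + t)).

(** [V] and [U taus] are the first and second s-derivatives of [e]. The relations [tauE] and [V = 0]
    are linear in a' and b, and so is [U] after the substitution for [taus]; hence both parameters
    can be eliminated linearly. *)
Lemma convexity_certificate : xb <= z -> w <= x -> e < 0 -> V = 0 -> U taus < 0.
Proof.
move=> zx wx e_lt0 V0.
pose f := - e; pose N := x - w; pose P := z - xb.
have f_gt0 : 0 < f by rewrite oppr_gt0.
have N_ge0 : 0 <= N by rewrite subr_ge0.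
have P_ge0 : 0 <= P by rewrite subr_ge0.
have -> : taus = - (Ps + Ns) by move: V0; rewrite /V; lra.
(* Only [0 <= det] will be established, so the sign of [U] comes from a contradiction rather than
   from a division by [det]. *)
rewrite ltNge; apply/negP => U_ge0.
pose A0 := 2 * xb ^+ 3 - 2 * z ^+ 3 + e * z * (3 * z + (xb - x) - e).
pose A2 := xb ^+ 2 - z ^+ 2 + e * z.
pose B0 := - 2 * x ^+ 3 + 2 * w ^+ 3 - e * w * (- 3 * w + (xb - x) - e).
pose B2 := x ^+ 2 - w ^+ 2 - e * w.
(* This is [P * Ns - N * Ps], the determinant of [tauE] and [V = 0] as a linear system in a' and b,
   rewritten without negative terms. *)
pose det := P * (N * (2 * w + N + 2 * xb + P + f) + w * f) + xb * N * f.
(* m1 and m2 are the multipliers for which a' and b cancel in the identity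
   [key]; the three remaining coefficients turn out to be polynomials in
   xb, w, N, P and f without negative terms. *)
pose m2 := A0 * N - P * B0 + 3 * (xb - x) * det.
pose m1 := A0 * B2 - A2 * B0 + (xb - x) * m2 +
  (2 * (x * xb) - (xb - x) ^+ 2) * det.
have det_ge0 : 0 <= det by rewrite /det; positivity.
pose cdl := N * (P * (xb * (xb * (8 * w + 4 * N + 2 * xb + 4 * P + 5 * f) + w
  * (6 * w + 6 * N + 14 * f + 12 * P) + P * (2 * P + 3 * f + 6 * N) + N * (2 *
  N + 6 * f) + f * f) + w * (P * (4 * P + 7 * f + 6 * w + 6 * N) + f * (4 * w
  + 3 * N + 2 * f)) + N * (P * (2 * P + 3 * f + 2 * N) + f * (N + f))) + xb *
  (f * (xb * (2 * xb + 7 * w + 3 * N + f) + w * (4 * w + 3 * N + 2 * f) + N *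
  (N + f)))) + w * (f * (P * (xb * (3 * xb + 4 * w + 5 * f + 5 * P) + P * (2 *
  P + 2 * f + 4 * w) + 3 * w * f) + xb * (f * (3 * xb + 3 * w)))).
pose cdl' := w * (P * (N * (w * (xb * (8 * w + 6 * xb + 6 * P + 15 * f + 12 *
  N) + w * (2 * w + 4 * N + 4 * P + 6 * f) + P * (2 * P + 8 * f + 6 * N) + N *
  (2 * N + 4 * f) + 2 * f * f) + xb * (N * (6 * xb + 6 * P + 8 * f + 4 * N) +
  f * (4 * xb + 5 * P + 4 * f)) + P * (N * (2 * P + 4 * f + 2 * N) + f * (2 *
  P + 2 * f))) + w * (f * (xb * (7 * w + 4 * xb + 5 * P + 4 * f) + w * (2 * w
  + 2 * f + 4 * P) + P * (2 * P + 2 * f)))) + xb * (f * (N * (w * (3 * w + 4 *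
  xb + 4 * N + 4 * f) + N * (4 * xb + N + f) + 3 * xb * f) + w * (f * (3 * xb
  + 3 * w))))).
pose ce := P * (w * (N * (xb * (6 * xb + 8 * P + 10 * f + 6 * w + 4 * N) + w *
  (4 * f + 4 * P + 2 * w + 2 * N) + P * (2 * P + 4 * f + 2 * N)) + f * (xb *
  (3 * xb + 5 * P + 5 * f + 5 * w) + w * (2 * f + 4 * P + 2 * w) + P * (2 * P
  + 2 * f))) + xb * (N * (xb * (2 * N + 2 * xb + 4 * P + 5 * f) + P * (2 * N +
  2 * P + 3 * f) + f * (N + f)))) + xb * (f * (N * (xb * (5 * w + N + 2 * xb +
  f) + w * (3 * w + N + f)) + w * (f * (3 * xb + 3 * w)))).
have cdl_ge0 : 0 <= cdl by rewrite /cdl; positivity.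
have cdl'_ge0 : 0 <= cdl' by rewrite /cdl'; positivity.
have ce_gt0 : 0 < ce.
  (* Strictness comes from the last summand, a product of [xb], [w], [f] and [3 * xb + 3 * w], which
     stays positive even when [P] and [N] vanish. *)
  rewrite /ce; apply: ltr_wpDl; first positivity.
  do 2 (apply: mulr_gt0 => //).
  by apply: ltr_wpDl; [positivity|rewrite !(mulr_gt0, addr_gt0)].
have key : det * U (- (Ps + Ns)) +
    m1 * (- a' * P - b * N + dl * xb + dl' * w - tau) - m2 * V =
    - (dl * (xb * cdl) + dl' * cdl' + ce * f).
  rewrite /cdl /cdl' /ce /m1 /m2 /det /A0 /A2 /B0 /B2 /V /U /Pss /Nss /taus.
  rewrite /Ps /Ns /f /Ds /D /P /N /e.
  by ring.
move: key; rewrite -tauE subrr V0 !mulr0 addr0 subr0.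
move=> key; have : det * U (- (Ps + Ns)) < 0.
  by rewrite key oppr_lt0 ltr_wpDl ?mulr_gt0//; positivity.
by apply/negP; rewrite -leNgt mulr_ge0.
Qed.
End certificates.

(** * Minimum principle *)

Lemma derive_lt0_near_right (R : realType) (V : R -> R) (m u : R) :
  is_derive m 1 V u -> u < 0 -> V m = 0 -> \forall x \near m^'+, V x < 0.
Proof.
move=> [dV Vu] u_lt0 Vm0.
have : h^-1 *: (V (h *: 1 + m) - V m) @[h --> 0^'] --> u.
  by rewrite -Vu; exact: dV.
move=> /cvg_dnbhs_at_right /(cvgr_lt u) /(_ 0 u_lt0) lt0.
apply/nbhs_right0P; near=> h.
have h_gt0 : 0 < h by near: h; exact: nbhs_right_gt.
rewrite addrC -(pmulr_rlt0 (x := h^-1)) ?invr_gt0//.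
have : h^-1 *: (V (h *: 1 + m) - V m) < 0 by near: h.
by rewrite Vm0 subr0 [_%:A]mulr1.
Unshelve. all: by end_near. Qed.

(** Second derivative test at an interior minimum, which exists because W exceeds a given negative
    value near both ends. Writing W' as [V * k] with k positive means that only [V] has to be
    differentiated: [U < 0] makes [V], hence W', negative just to the right of the minimum. *)
Lemma minimum_principle (R : realType) (W V k U : R -> R) (l0 l1 : R) :
  (forall x : R, x \in `]0, 1[ -> is_derive x 1 W (V x * k x)) ->
  (forall x : R, x \in `]0, 1[ -> 0 < k x) ->
  (forall x : R, x \in `]0, 1[ -> is_derive x 1 V (U x)) ->
  W x @[x --> 0^'+] --> l0 -> W x @[x --> 1^'-] --> l1 -> 0 <= l0 -> 0 <= l1 ->
  (forall x : R, x \in `]0, 1[ -> W x < 0 -> V x = 0 -> U x < 0) ->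
  forall x : R, x \in `]0, 1[ -> 0 <= W x.
Proof.
move=> dW k_gt0 dV W0 W1 l0_ge0 l1_ge0 noneg c c01.
rewrite leNgt; apply/negP => Wc_lt0.
have [c_gt0 c_lt1] : 0 < c /\ c < 1 by move: c01; rewrite in_itv/= => /andP.
have [s [s_gt0 sc Ws]] : exists s, [/\ 0 < s, s < c & W c < W s].
  near ((0:R)^'+) => s; exists s; split => //.
  by near: s; apply: (cvgr_gt l0) => //; exact: lt_le_trans l0_ge0.
have [t [t_lt1 ct Wt]] : exists t, [/\ t < 1, c < t & W c < W t].
  near ((1:R)^'-) => t; exists t; split => //.
  by near: t; apply: (cvgr_gt l1) => //; exact: lt_le_trans l1_ge0.
have st01 x : x \in `[s, t] -> x \in `]0, 1[.
  by rewrite !in_itv/= => /andP[sx xt]; rewrite (lt_le_trans s_gt0)//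
    (le_lt_trans xt).
have sot x : x \in `]s, t[ -> x \in `[s, t] by exact: subset_itv_oo_cc.
have [m mst minm] : exists2 m, m \in `[s, t] & forall x, x \in `[s, t] ->
  W m <= W x.
  apply: EVT_min; first exact/ltW/(lt_trans sc).
  apply: derivable_within_continuous => x xst.
  by have [] := dW x (st01 _ xst).
have Wmc : W m <= W c by apply: minm; rewrite in_itv/= !ltW.
have m_st : m \in `]s, t[.
  move: mst; rewrite !in_itv/= => /andP[sm mt]; rewrite !lt_neqAle sm mt !andbT.
  apply/andP; split; apply/eqP => eqm; move: Wmc.
    by rewrite -eqm leNgt Ws.
  by rewrite eqm leNgt Wt.
have m01 := st01 _ mst.
have Vm0 : V m = 0.
  have st : s <= t by apply/ltW/(lt_trans sc).
  have : is_derive m 1 W 0.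
    apply: (derive1_at_min st _ m_st) => x xst.
      by have [] := dW x (st01 _ (sot _ xst)).
    exact/minm/sot.
  move=> [_]; have [_ ->] := dW m m01 => /eqP.
  by rewrite mulf_eq0 (gt_eqF (k_gt0 _ m01)) orbF => /eqP.
have Um_lt0 := noneg m m01 (le_lt_trans Wmc Wc_lt0) Vm0.
have [st sm mt] : [/\ s < t, s < m & m < t].
  by move: m_st; rewrite in_itv/= => /andP[? ?]; split => //;
    exact: lt_trans ct.
have [e /= e_gt0 V_lt0] := derive_lt0_near_right (dV m m01) Um_lt0 Vm0.
have [u [mu ut ume]] : exists u, [/\ m < u, u < t & u - m < e].
  near m^'+ => u; exists u; split => //.
  by near: u; exact: nbhs_right_ltDr.
have uI x : x \in `[m, u] -> x \in `[s, t].
  rewrite !in_itv/= => /andP[mx xu].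
  by rewrite (le_trans (ltW sm))//= (le_trans xu)// ltW.
have muo x : x \in `]m, u[ -> x \in `]0, 1[.
  by move=> xmu; apply/st01/uI; exact: subset_itv_oo_cc xmu.
have cW : {within `[m, u], continuous W}.
  apply: derivable_within_continuous => x xmu.
  by have [] := dW x (st01 _ (uI _ xmu)).
have [x xmu] := MVT mu (fun x xmu => dW x (muo x xmu)) cW.
have x01 := muo _ xmu.
have : W m <= W u by apply/minm/uI; rewrite in_itv/= lexx ltW.
rewrite -subr_ge0 => /[swap] ->; rewrite leNgt => /negP; apply.
rewrite pmulr_llt0 ?subr_gt0// pmulr_llt0 ?k_gt0//.
move: xmu; rewrite in_itv/= => /andP[mx xu].
apply: V_lt0 => //=; rewrite /ball/= ltr0_norm ?subr_lt0// opprB.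
by rewrite (lt_trans _ ume)// ltrD2r.
Unshelve. all: by end_near. Qed.

(** On the segment from x to u, convexity bounds the difference quotients at x by [f u - f x].
    Parametrizing by h in [0, 1] treats u on either side of x alike, and f may fail to be
    differentiable at u. *)
Lemma convex_function_tangent (R : realType) (D : set R) (f : R -> R)
    (x u l : R) :
  convex_function (D : set (convex_lmodType R^o)) f -> D x -> D u ->
  is_derive x 1 f l -> f x + l * (u - x) <= f u.
Proof.
move=> conv_f Dx Du df; rewrite addrC -lerBrDr.
pose g (h : R) := f (x + h * (u - x)).
have dg : is_derive (0 : R) 1 g (l * (u - x)).
  have h1 : is_derive (0 : R) 1 (fun h : R => x + h * (u - x)) (u - x).
    by apply: is_derive_eq; rewrite /GRing.scale/=; ring.
  by apply: is_derive1_comp h1; rewrite mul0r addr0.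
have : h^-1 *: (g (h *: 1 + 0) - g 0) @[h --> 0^'] --> l * (u - x).
  by have [dg0 <-] := dg; exact: dg0.
move=> /cvg_dnbhs_at_right cvg_g; apply: cvgr_to_le cvg_g _.
near=> h; have h_gt0 : 0 < h by [].
have h_le1 : h <= 1 by near: h; exact: nbhs_right_le.
have le_conv : f (h * u + (1 - h) * x) <= h * f u + (1 - h) * f x.
  by apply: (conv_f (Itv01 (ltW h_gt0) h_le1)); rewrite inE.
rewrite /GRing.scale/= ler_pdivrMl// addr0 mulr1 /g mul0r addr0.
have -> : x + h * (u - x) = h * u + (1 - h) * x by ring.
lra.
Unshelve. all: by end_near. Qed.

(** * The differential equation of the transform *)

Section beta_transform_equation.
Variables (R : realType) (a b a' b' : R) (y q : R -> R).
Hypotheses (a'_gt0 : 0 < a') (b_gt0 : 0 < b) (aa' : a' <= a) (bb' : b <= b').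

Let tau (x : R) : R := a * (1 - x) - b * x - (a' * (1 - y x) - b' * y x) * q x.
(** The factor that turns a derivative with respect to s into one with respect to x. *)
Let k (x : R) : R := (x * (1 - x))^-1.

Hypothesis y01 : forall x : R, x \in `]0, 1[ -> 0 < y x < 1.
Hypothesis y_le : forall x : R, x \in `]0, 1[ -> y x <= x.
Hypothesis q_gt0 : forall x : R, x \in `]0, 1[ -> 0 < q x.
Hypothesis dy : forall x : R, x \in `]0, 1[ ->
  is_derive x 1 y (y x * (1 - y x) * q x * k x).
Hypothesis dq : forall x : R, x \in `]0, 1[ ->
  is_derive x 1 q (q x * tau x * k x).
Hypotheses (y_cvg0 : y x @[x --> (0 : R)^'+] --> (0 : R)).
Hypotheses (y_cvg1 : y x @[x --> (1 : R)^'-] --> (1 : R)).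
Hypotheses (q_cvg0 : q x @[x --> (0 : R)^'+] --> a / a').
Hypotheses (q_cvg1 : q x @[x --> (1 : R)^'-] --> b / b').

Let a_gt0 : 0 < a. Proof. exact: lt_le_trans aa'. Qed.
Let b'_gt0 : 0 < b'. Proof. exact: lt_le_trans bb'. Qed.

Let id_cvg0 : x @[x --> (0 : R)^'+] --> (0 : R).
Proof. by apply: cvg_at_right_filter; exact: cvg_id. Qed.

Let id_cvg1 : x @[x --> (1 : R)^'-] --> (1 : R).
Proof. by apply: cvg_at_left_filter; exact: cvg_id. Qed.

Let k_gt0 (x : R) : x \in `]0, 1[ -> 0 < k x.
Proof.
rewrite in_itv/= => /andP[x_gt0 x_lt1].
by rewrite invr_gt0 mulr_gt0// subr_gt0.
Qed.

(** The form required by the hypothesis [tauE] of the certificates, with the nonnegative differences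
    a - a' and b' - b set apart. *)
Let tau_split (x : R) : tau x = - a' * (q x * (1 - y x) - (1 - x))
  - b * (x - y x * q x) + (a - a') * (1 - x) + (b' - b) * (y x * q x).
Proof. by rewrite /tau; ring. Qed.

(** * The quantities of the certificates as functions of x, and their derivatives *)

Let D (x : R) : R := x * (1 - x) - q x * (1 - y x) * (y x * q x).
Let Ds (x : R) : R := x * (1 - x) * (1 - x - x) -
  q x * (1 - y x) * (y x * q x) * (2 * tau x + q x * (1 - y x) - y x * q x).
Let taus (x : R) : R := - a' * (D x + q x * (1 - y x) * tau x)
  - b * (D x - y x * q x * tau x) - (a - a') * (x * (1 - x))
  + (b' - b) * (y x * q x * (q x * (1 - y x) + tau x)).

Let zm (x : R) : R := q x * (1 - y x).
Let wm (x : R) : R := y x * q x.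

Let neq0 (x : R) : x \in `]0, 1[ -> (x != 0) * (1 - x != 0) * (q x != 0).
Proof.
move=> x01; have qx := q_gt0 x01; move: x01.
rewrite in_itv/= => /andP[x_gt0 x_lt1].
by split; [split|]; rewrite gt_eqF// subr_gt0.
Qed.

Let dz (x : R) : x \in `]0, 1[ ->
  is_derive x 1 zm (zm x * (tau x - wm x) * k x).
Proof.
move=> x01; have h1 := dy x01; have h2 := dq x01.
by apply: is_derive_eq; rewrite /GRing.scale/= /zm /wm; ring.
Qed.

Let dw (x : R) : x \in `]0, 1[ ->
  is_derive x 1 wm (wm x * (tau x + zm x) * k x).
Proof.
move=> x01; have h1 := dy x01; have h2 := dq x01.
by apply: is_derive_eq; rewrite /GRing.scale/= /zm /wm; ring.
Qed.

Let dtau (x : R) : x \in `]0, 1[ -> is_derive x 1 tau (taus x * k x).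
Proof.
move=> x01; have h1 := dy x01; have h2 := dq x01.
apply: is_derive_eq; rewrite /GRing.scale/= /taus /D /k.
by field; rewrite !(neq0 x01).
Qed.

Let dD (x : R) : x \in `]0, 1[ -> is_derive x 1 D (Ds x * k x).
Proof.
move=> x01; have h1 := dy x01; have h2 := dq x01.
apply: is_derive_eq; rewrite /GRing.scale/= /Ds /k.
by field; rewrite !(neq0 x01).
Qed.

(** Equivalent to x y' >= y, that is, y/x is nondecreasing. The minimum principle is applied to (z -
    xb)/q, with limits 1 - a'/a at 0 and 0 at 1. *)
Lemma starshaped_left (x : R) : x \in `]0, 1[ -> 1 - x <= q x * (1 - y x).
Proof.
move=> x01; rewrite -subr_ge0.
suff : 0 <= (1 - y x) - (1 - x) / q x.
  move/(mulr_ge0 (ltW (q_gt0 x01))).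
  by rewrite mulrBr mulrCA mulfV ?(neq0 x01)// mulr1.
apply: (@minimum_principle R (fun t => (1 - y t) - (1 - t) / q t)
  (fun t => D t + (1 - t) * tau t) (fun t => k t / q t)
  (fun t => (Ds t - t * (1 - t) * tau t + (1 - t) * taus t) * k t)
  (1 - a' / a) 0 _ _ _ _ _ _ _ _ x x01).
- move=> t t01; have h1 := dy t01; have qt_neq0 :
    q t != 0 by rewrite (neq0 t01).
  have h2 := is_deriveV qt_neq0 (dq t01).
  apply: is_derive_eq; rewrite /GRing.scale/= /D /k.
  by field; rewrite !(neq0 t01).
- by move=> t t01; rewrite divr_gt0 ?k_gt0 ?q_gt0.
- move=> t t01; have h1 := dtau t01; have h2 := dD t01.
  apply: is_derive_eq; rewrite /GRing.scale/= /k.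
  by field; rewrite !(neq0 t01).
- rewrite (_ : 1 - a' / a = 1 - 0 - (1 - 0) / (a / a')).
    apply: cvgB; first by apply: cvgB => //; exact: cvg_cst.
    apply: cvgM; first by apply: cvgB => //; exact: cvg_cst.
    by apply: cvgV => //; rewrite gt_eqF// divr_gt0.
  by field; rewrite !gt_eqF.
- rewrite (_ : 0 = 1 - 1 - (1 - 1) / (b / b'));
    last by rewrite !subrr mul0r subrr.
  apply: cvgB; first by apply: cvgB => //; exact: cvg_cst.
  apply: cvgM; first by apply: cvgB => //; exact: cvg_cst.
  by apply: cvgV => //; rewrite gt_eqF// divr_gt0.
- by rewrite subr_ge0 ler_pdivrMr// mul1r.
- by [].
move=> t t01 W_lt0 V0; rewrite pmulr_llt0 ?k_gt0//.
have [y_gt0 y_lt1] := andP (y01 t01); have qt := q_gt0 t01.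
have z_lt : zm t < 1 - t.
  by move: W_lt0; rewrite subr_lt0 ltr_pdivlMr// mulrC.
have tc_gt0 : 0 < 1 - t.
  by apply: lt_trans z_lt; rewrite mulr_gt0// subr_gt0.
(* Since y <= t, one has q (1 - y) < 1 - t <= 1 - y. The bound q < 1 then yields w < t, the other
   strict inequality of the certificate. *)
have q_lt1 : q t < 1.
  rewrite -(ltr_pM2r (x := 1 - y t)) ?subr_gt0// mul1r (lt_le_trans z_lt)//.
  by rewrite lerD2l lerN2 y_le.
have w_lt : wm t < t.
  by rewrite (lt_le_trans _ (y_le t01))// gtr_pMr.
apply: (@starshaped_left_certificate _ a' b (a - a') (b' - b) t (1 - t) (zm t)
  (wm t) (tau t)) => //.
- by rewrite subr_ge0.
- by rewrite subr_ge0.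
- by rewrite mulr_gt0.
- exact: ltW.
- by rewrite mulr_gt0// subr_gt0.
Qed.

(** Equivalent to (1 - x) y' <= 1 - y, that is, (1 - y)/(1 - x) is nondecreasing. *)
Lemma starshaped_right (x : R) : x \in `]0, 1[ -> y x * q x <= x.
Proof.
move=> x01; rewrite -subr_ge0.
apply: (@minimum_principle R (fun t => t - wm t)
  (fun t => D t - wm t * tau t) k
  (fun t => (Ds t - wm t * (tau t * (tau t + zm t) + taus t)) * k t)
  0 (1 - b / b') _ _ _ _ _ _ _ _ x x01).
- move=> t t01; have h1 := dw t01.
  apply: is_derive_eq; rewrite /GRing.scale/= /D -/(wm t) -/(zm t) /k.
  by field; rewrite !(neq0 t01).
- exact: k_gt0.
- move=> t t01; have h1 := dtau t01; have h2 := dD t01; have h3 := dw t01.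
  by apply: is_derive_eq; rewrite /GRing.scale/=; ring.
- rewrite -[X in _ --> X](subr0 0) -[X in _ --> _ - X](mul0r (a / a')) /wm.
  by apply: cvgB; [exact: id_cvg0|exact: cvgM y_cvg0 q_cvg0].
- rewrite -[b / b']mul1r.
  by rewrite /wm; apply: cvgB; [exact: id_cvg1|exact: cvgM y_cvg1 q_cvg1].
- by [].
- by rewrite subr_ge0 ler_pdivrMr// mul1r.
move=> t t01 W_lt0 V0; rewrite pmulr_llt0 ?k_gt0//.
have [y_gt0 y_lt1] := andP (y01 t01); have qt := q_gt0 t01.
have [t_gt0 t_lt1] : 0 < t /\ t < 1 by move: t01; rewrite in_itv/= => /andP.
have w_gt : t < wm t by rewrite -subr_lt0.
(* Here y q > t >= y, and q > 1 in turn gives z > 1 - y >= 1 - t. *)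
have q_gt1 : 1 < q t.
  rewrite -(ltr_pM2l y_gt0) mulr1 (le_lt_trans _ w_gt)//.
  exact: y_le.
have z_gt : 1 - t < zm t.
  apply: (@le_lt_trans _ _ (1 - y t)); first by rewrite lerD2l lerN2 y_le.
  by rewrite /zm ltr_pMl// subr_gt0.
apply: (@starshaped_right_certificate _ a' b (a - a') (b' - b) t (1 - t) (zm t)
  (wm t) (tau t)) => //.
- by rewrite subr_ge0.
- by rewrite subr_ge0.
- by rewrite subr_gt0.
- by rewrite mulr_gt0.
- exact: ltW.
Qed.

Let cvg_E (F : set_system R) (FF : Filter F) (x0 y0 q0 : R) :
  x @[x --> F] --> x0 -> y x @[x --> F] --> y0 -> q x @[x --> F] --> q0 ->
  tau x + (zm x - (1 - x)) + (x - wm x) @[x --> F] -->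
  a * (1 - x0) - b * x0 - (a' * (1 - y0) - b' * y0) * q0 +
  (q0 * (1 - y0) - (1 - x0)) + (x0 - y0 * q0).
Proof.
move=> xF yF qF.
have onem (f : R -> R) (f0 : R) : f x @[x --> F] --> f0 ->
  1 - f x @[x --> F] --> 1 - f0.
  by move=> fF; apply: cvgB fF; exact: cvg_cst.
have scale (c : R) (f : R -> R) (f0 : R) : f x @[x --> F] --> f0 ->
  c * f x @[x --> F] --> c * f0.
  by move=> fF; apply: cvgM fF; exact: cvg_cst.
have tF : tau x @[x --> F] --> a * (1 - x0) - b * x0 -
  (a' * (1 - y0) - b' * y0) * q0.
  rewrite /tau; apply: cvgB; [apply: cvgB|apply: cvgM => //; apply: cvgB];
    by apply: scale => //; exact: onem.
have zF : zm x - (1 - x) @[x --> F] --> q0 * (1 - y0) - (1 - x0).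
  by rewrite /zm; apply: cvgB; [apply: cvgM => //|]; exact: onem.
have wF : x - wm x @[x --> F] --> x0 - y0 * q0.
  by rewrite /wm; apply: cvgB => //; exact: cvgM.
by apply: cvgD wF; exact: cvgD.
Qed.

(** The expression is E, which has the sign of y''. The two preceding lemmas provide the
    inequalities xb <= z and w <= x of [convexity_certificate]. *)
Lemma relative_convexity_ge0 (x : R) : x \in `]0, 1[ ->
  0 <= tau x + (q x * (1 - y x) - (1 - x)) + (x - y x * q x).
Proof.
move=> x01.
apply: (@minimum_principle R (fun t => tau t + (zm t - (1 - t)) + (t - wm t))
  (fun t => taus t + (D t + zm t * tau t) + (D t - wm t * tau t)) k
  (fun t => ((1 - a') * (Ds t + zm t * (tau t * (tau t - wm t) + taus t))
    + (1 - b) * (Ds t - wm t * (tau t * (tau t + zm t) + taus t))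
    - (a - a') * (t * (1 - t) * (1 - t - t))
    + (b' - b) * (wm t *
        ((zm t + tau t) ^+ 2 + zm t * (tau t - wm t) + taus t)))
    * k t)
  (a / a' - 1) (1 - b / b') _ _ _ _ _ _ _ _ x x01).
- move=> t t01; have h1 := dw t01; have h2 := dz t01; have h3 := dtau t01.
  apply: is_derive_eq; rewrite /GRing.scale/= /D -/(wm t) -/(zm t) /k.
  by field; rewrite !(neq0 t01).
- exact: k_gt0.
- move=> t t01; have h1 := dw t01; have h2 := dz t01; have h3 := dtau t01.
  have h4 := dD t01.
  apply: is_derive_eq; rewrite /GRing.scale/= -/(wm t) -/(zm t) /k.
  by field; rewrite !(neq0 t01).
- rewrite (_ : a / a' - 1 = a * (1 - 0) - b * 0 -
      (a' * (1 - 0) - b' * 0) * (a / a') + (a / a' * (1 - 0) - (1 - 0)) +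
      (0 - 0 * (a / a'))); last by field; rewrite gt_eqF.
  exact: cvg_E.
- rewrite (_ : 1 - b / b' = a * (1 - 1) - b * 1 -
      (a' * (1 - 1) - b' * 1) * (b / b') + (b / b' * (1 - 1) - (1 - 1)) +
      (1 - 1 * (b / b'))); last by field; rewrite gt_eqF.
  exact: cvg_E.
- by rewrite subr_ge0 ler_pdivlMr// mul1r.
- by rewrite subr_ge0 ler_pdivrMr// mul1r.
move=> t t01 W_lt0 V0; rewrite pmulr_llt0 ?k_gt0//.
have [y_gt0 y_lt1] := andP (y01 t01).
apply: (@convexity_certificate _ a' b (a - a') (b' - b) t (1 - t) (zm t) (wm t)
  (tau t)) => //.
- by rewrite subr_ge0.
- by rewrite subr_ge0.
- by move: t01; rewrite in_itv/= subr_gt0 => /andP[].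
- by rewrite mulr_gt0 ?q_gt0.
- exact: starshaped_left.
- exact: starshaped_right.
Qed.

End beta_transform_equation.

(** * Beta distribution functions *)

Lemma is_derive_onem_powR (R : realType) (r x : R) : x < 1 ->
  is_derive x 1 (fun t => (1 - t) `^ r) (r * (1 - x) `^ (r - 1) * (0 - 1)).
Proof.
rewrite -subr_gt0 => /(is_derive1_powR r) h.
exact: (@is_derive1_comp _ (fun t => t `^ r) (fun t => 1 - t)).
Qed.

(** The analytic facts about a beta distribution function on which the argument rests; [C] stands
    for 1/B(a, b). *)
Definition is_beta_df (R : realType) (a b C : R) (F : R -> R) : Prop :=
  [/\ 0 < C, F 0 = 0, F 1 = 1, {within `[0, 1], continuous F} &
      forall x : R, x \in `]0, 1[ -> is_derive x 1 F (C * beta_kernel a b x)].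

Section beta_df_theory.
Variables (R : realType) (a b C : R) (F : R -> R).
Hypotheses (a_gt0 : 0 < a) (b_gt0 : 0 < b) (F_beta : is_beta_df a b C F).

Lemma beta_kernel_gt0 (x : R) : x \in `]0, 1[ -> 0 < beta_kernel a b x.
Proof.
rewrite in_itv/= => /andP[x_gt0 x_lt1].
by rewrite mulr_gt0 ?powR_gt0// subr_gt0.
Qed.

Lemma beta_df_lt : {in `[0, 1] &, {homo F : x y / x < y}}.
Proof.
have [C_gt0 _ _ cF dF] := F_beta.
apply: gtr0_derive1_lt_cc cF => x x01; have [dFx Fx] := dF x x01;
  first exact: dFx.
by rewrite derive1E Fx mulr_gt0// beta_kernel_gt0.
Qed.

Lemma beta_df_le : {in `[0, 1] &, {mono F : x y / x <= y}}.
Proof. exact: le_mono_in beta_df_lt. Qed.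

Lemma beta_df_inj : {in `[0, 1] &, injective F}.
Proof. exact: inc_inj_in beta_df_le. Qed.

Lemma beta_df_itvoo (x : R) : x \in `]0, 1[ -> F x \in `]0, 1[.
Proof.
have [_ F0 F1 _ _] := F_beta.
move=> x01; have xcc := subset_itv_oo_cc x01.
move: (x01); rewrite !in_itv/= -[X in X < F x]F0 -[X in F x < X]F1 => /andP[?
  ?].
by rewrite !beta_df_lt// in_itv/= lexx ler01.
Qed.

Lemma beta_df_cvg0 : F x @[x --> (0 : R)^'+] --> (0 : R).
Proof.
have [_ F0 _ /(continuous_within_itvP _ ltr01)[_ + _] _] := F_beta.
by rewrite F0.
Qed.

Lemma beta_df_cvg1 : F x @[x --> (1 : R)^'-] --> (1 : R).
Proof.
have [_ _ F1 /(continuous_within_itvP _ ltr01)[_ _ +] _] := F_beta.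
by rewrite F1.
Qed.

(* x (1 - x) F'(x), see beta_bumpE; in this form it is continuous on [0, 1]. *)
Definition beta_bump (x : R) : R := C * (x `^ a * (1 - x) `^ b).

Lemma beta_bumpE (x : R) : x \in `]0, 1[ ->
  beta_bump x = x * (1 - x) * (C * beta_kernel a b x).
Proof.
rewrite in_itv/= => /andP[x_gt0 x_lt1]; have xc_gt0 :
  0 < 1 - x by rewrite subr_gt0.
rewrite /beta_bump /beta_kernel -(mulr_powRB1 (ltW x_gt0) a_gt0).
by rewrite -(mulr_powRB1 (ltW xc_gt0) b_gt0); ring.
Qed.

Lemma beta_bump_gt0 (x : R) : x \in `]0, 1[ -> 0 < beta_bump x.
Proof.
rewrite in_itv/= => /andP[x_gt0 x_lt1]; have [C_gt0 _ _ _ _] := F_beta.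
by rewrite !mulr_gt0 ?powR_gt0// subr_gt0.
Qed.

Lemma is_derive_beta_bump (x : R) : x \in `]0, 1[ ->
  is_derive x 1 beta_bump ((a - (a + b) * x) * (C * beta_kernel a b x)).
Proof.
move=> x01; move: (x01); rewrite in_itv/= => /andP[x_gt0 x_lt1].
have xc_gt0 : 0 < 1 - x by rewrite subr_gt0.
have h1 := is_derive1_powR a x_gt0.
have h2 := is_derive_onem_powR b x_lt1.
apply: is_derive_eq; rewrite /GRing.scale/= /beta_kernel.
rewrite -(mulr_powRB1 (ltW x_gt0) a_gt0).
by rewrite -(mulr_powRB1 (ltW xc_gt0) b_gt0); ring.
Qed.

Let is_derive_continuous (f : R -> R) (x l : R) : is_derive x 1 f l ->
  f t @[t --> x] --> f x.
Proof.
by move=> [df _]; apply: differentiable_continuous; exact/derivable1_diffP.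
Qed.

Lemma beta_bump_cvg0 : beta_bump x @[x --> (0 : R)^'+] --> (0 : R).
Proof.
have h : (1 - x) `^ b @[x --> (0 : R)^'+] --> (1 - 0) `^ b.
  apply: (@cvg_at_right_filter _ _ (fun x => (1 - x) `^ b)).
  by apply: is_derive_continuous (is_derive_onem_powR _ _).
suff : beta_bump x @[x --> (0 : R)^'+] --> C * (0 * (1 - 0) `^ b).
  by rewrite mul0r mulr0.
apply: cvgM; first exact: cvg_cst.
by apply: cvgM => //; exact: powR_cvg0.
Qed.

Lemma beta_bump_cvg1 : beta_bump x @[x --> (1 : R)^'-] --> (0 : R).
Proof.
have h : x `^ a @[x --> (1 : R)^'-] --> 1 `^ a.
  apply: (@cvg_at_left_filter _ _ (fun x => x `^ a)).
  by apply: is_derive_continuous (is_derive1_powR a ltr01).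
have onem_cvg : 1 - x @[x --> (1 : R)^'-] --> (0 : R)^'+.
  move=> A A0; apply/nbhs_left0P; near=> e.
  by rewrite /= opprB addrC subrK; near: e.
suff : beta_bump x @[x --> (1 : R)^'-] --> C * (1 `^ a * 0).
  by rewrite !mulr0.
apply: cvgM; first exact: cvg_cst.
apply: cvgM => //.
exact: (cvg_comp _ _ onem_cvg (powR_cvg0 b_gt0)).
Unshelve. all: by end_near. Qed.

Let id_cvg0 : x @[x --> (0 : R)^'+] --> (0 : R).
Proof. by apply: cvg_at_right_filter; exact: cvg_id. Qed.

Let id_cvg1 : x @[x --> (1 : R)^'-] --> (1 : R).
Proof. by apply: cvg_at_left_filter; exact: cvg_id. Qed.

(** L'Hopital's rule: the kernel cancels in the quotient of the derivatives, leaving exactly a - (a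
    + b) x. *)
Lemma beta_bump_df_cvg0 : beta_bump x / F x @[x --> (0 : R)^'+] --> a.
Proof.
have [C_gt0 _ _ _ dF] := F_beta.
apply: (lhopital_at_right ltr01 is_derive_beta_bump dF) => //.
- exact: beta_bump_cvg0.
- exact: beta_df_cvg0.
- by move=> x x01; rewrite gt_eqF// mulr_gt0// beta_kernel_gt0.
have : a - (a + b) * x @[x --> (0 : R)^'+] --> a.
  suff : a - (a + b) * x @[x --> (0 : R)^'+] --> a - (a + b) * 0.
    by rewrite mulr0 subr0.
  apply: cvgB; [exact: cvg_cst|apply: cvgM; [exact: cvg_cst|exact: id_cvg0]].
apply: cvg_trans; apply: near_eq_cvg; near=> x.
rewrite mulfK// gt_eqF// mulr_gt0// beta_kernel_gt0// in_itv/=.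
by apply/andP; split.
Unshelve. all: by end_near. Qed.

(** As at 0, but the derivative of 1 - F is - F', so the quotient of the derivatives is (a + b) x -
    a. *)
Lemma beta_bump_df_cvg1 : beta_bump x / (1 - F x) @[x --> (1 : R)^'-] --> b.
Proof.
have [C_gt0 _ _ _ dF] := F_beta.
have dF1 (x : R) : x \in `]0, 1[ ->
    is_derive x 1 (fun t => 1 - F t) (- (C * beta_kernel a b x)).
  move=> x01; have h := dF x x01.
  by apply: is_derive_eq; ring.
apply: (lhopital_at_left ltr01 is_derive_beta_bump dF1) => //.
- exact: beta_bump_cvg1.
- suff : 1 - F x @[x --> (1 : R)^'-] --> 1 - (1 : R) by rewrite subrr.
  by apply: cvgB; [exact: cvg_cst|exact: beta_df_cvg1].
- by move=> x x01; rewrite oppr_eq0 gt_eqF// mulr_gt0// beta_kernel_gt0.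
have : (a + b) * x - a @[x --> (1 : R)^'-] --> b.
  suff : (a + b) * x - a @[x --> (1 : R)^'-] --> (a + b) * 1 - a.
    by rewrite mulr1 addrAC subrr add0r.
  apply: cvgB; [apply: cvgM; [exact: cvg_cst|exact: id_cvg1]|exact: cvg_cst].
apply: cvg_trans; apply: near_eq_cvg; near=> x.
rewrite -[a - _]opprB mulNr invrN mulrNN mulfK// gt_eqF// mulr_gt0//
  beta_kernel_gt0// in_itv/=.
by apply/andP; split.
Unshelve. all: by end_near. Qed.

End beta_df_theory.

(** * The transform G^-1 o F *)

Section beta_transform.
Variables (R : realType) (a b C a' b' C' : R) (F G : R -> R).
Hypotheses (a_gt0 : 0 < a) (b_gt0 : 0 < b) (a'_gt0 : 0 < a') (b'_gt0 : 0 < b').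
Hypotheses (F_beta : is_beta_df a b C F) (G_beta : is_beta_df a' b' C' G).

Let phi (x : R) : R := pinv [set` `[(0 : R), 1]] G (F x).

Let Ginj : {in [set` `[(0 : R), 1]] &, injective G}.
Proof. by move=> x y; rewrite !inE; exact: beta_df_inj G_beta _ _. Qed.

Lemma beta_df_itvcc (x : R) : x \in `[0, 1] -> F x \in `[0, 1].
Proof.
have [_ F0 F1 _ _] := F_beta.
have le01 : (0 : R) <= 1 by exact: ler01.
move=> x01; move: (x01); rewrite !in_itv/= -[X in X <= F x]F0 -[X in F x <=
  X]F1.
by rewrite !(beta_df_le F_beta)// in_itv/= ?lexx ?le01.
Qed.

Lemma beta_transformP (x : R) : x \in `[0, 1] ->
  phi x \in `[0, 1] /\ G (phi x) = F x.
Proof.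
have [_ G0 G1 cG _] := G_beta.
move=> x01; have [|y y01 GyFx] := @IVT R G 0 1 (F x) ler01 cG.
  by rewrite G0 G1 min_l// max_r//; move: (beta_df_itvcc x01); rewrite in_itv.
have -> : phi x = y by rewrite /phi -GyFx pinvKV// inE.
by [].
Qed.

Lemma beta_transform_oo (x : R) : x \in `]0, 1[ -> phi x \in `]0, 1[.
Proof.
have [_ G0 G1 _ _] := G_beta.
move=> x01; have [] := beta_transformP (subset_itv_oo_cc x01).
rewrite !in_itv/= => /andP[p_ge0 p_le1] GFx.
have := beta_df_itvoo F_beta x01; rewrite in_itv/= -GFx => /andP[Gp_gt0 Gp_lt1].
rewrite !lt_neqAle p_ge0 p_le1 !andbT; apply/andP; split; apply/eqP => p_eq.
  by move: Gp_gt0; rewrite -p_eq G0 ltxx.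
by move: Gp_lt1; rewrite p_eq G1 ltxx.
Qed.

Lemma beta_transform0 : phi 0 = 0.
Proof.
have [_ F0 _ _ _] := F_beta; have [_ G0 _ _ _] := G_beta.
by rewrite /phi F0 -[X in pinv _ _ X]G0 pinvKV ?inE/= ?in_itv/= ?lexx ?ler01.
Qed.

Lemma beta_transform1 : phi 1 = 1.
Proof.
have [_ _ F1 _ _] := F_beta; have [_ _ G1 _ _] := G_beta.
by rewrite /phi F1 -[X in pinv _ _ X]G1 pinvKV ?inE/= ?in_itv/= ?lexx ?ler01.
Qed.

(** Monotonicity of G turns [phi x < d] into [F x < G d], which holds near 0 because F tends to
    0. *)
Lemma beta_transform_cvg0 : phi x @[x --> (0 : R)^'+] --> (0 : R).
Proof.
have [_ G0 _ _ _] := G_beta.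
(* The cap at 1 keeps [d] in [0, 1], where G is known to be increasing. *)
apply/cvgrPdist_lt => e e_gt0; pose d := Num.min e 1.
have d_gt0 : 0 < d by rewrite lt_min e_gt0 ltr01.
have dcc : d \in `[0, 1] by rewrite in_itv/= ltW// ge_min lexx orbT.
have Gd_gt0 : 0 < G d.
  rewrite -[X in X < _]G0; apply: (beta_df_lt G_beta) dcc d_gt0.
  by rewrite in_itv/= lexx ler01.
near=> x.
have x01 : x \in `]0, 1[ by rewrite in_itv/=; apply/andP; split.
have := beta_transform_oo x01; rewrite in_itv/= => /andP[p_gt0 p_lt1].
have [pcc GpF] := beta_transformP (subset_itv_oo_cc x01).
suff : phi x < d by rewrite sub0r normrN gtr0_norm// lt_min => /andP[].
rewrite ltNge -(beta_df_le G_beta)// GpF -ltNge.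
by near: x; apply: (cvgr_lt (0 : R)) => //; exact: beta_df_cvg0 F_beta.
Unshelve. all: by end_near. Qed.

Lemma beta_transform_cvg1 : phi x @[x --> (1 : R)^'-] --> (1 : R).
Proof.
have [_ _ G1 _ _] := G_beta.
apply/cvgrPdist_lt => e e_gt0; pose d := 1 - Num.min e 1.
have d_lt1 : d < 1 by rewrite gtrBl lt_min e_gt0 ltr01.
have dcc : d \in `[0, 1].
  by rewrite in_itv/= (ltW d_lt1) andbT subr_ge0 ge_min lexx orbT.
have Gd_lt1 : G d < 1.
  rewrite -[X in _ < X]G1; apply: (beta_df_lt G_beta) dcc _ d_lt1.
  by rewrite in_itv/= lexx ler01.
near=> x.
have x01 : x \in `]0, 1[ by rewrite in_itv/=; apply/andP; split.
have := beta_transform_oo x01; rewrite in_itv/= => /andP[p_gt0 p_lt1].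
have [pcc GpF] := beta_transformP (subset_itv_oo_cc x01).
suff : d < phi x.
  by rewrite gtr0_norm ?subr_gt0// /d ltrBlDr -ltrBlDl lt_min => /andP[].
rewrite ltNge -(beta_df_le G_beta)// GpF -ltNge.
by near: x; apply: (cvgr_gt (1 : R)) => //; exact: beta_df_cvg1 F_beta.
Unshelve. all: by end_near. Qed.

(** * The quotient q: differential equations and limits at the endpoints *)

Let q (x : R) : R := beta_bump a b C x / beta_bump a' b' C' (phi x).

(** The inverse function rule gives F'(x) / G'(phi x); [beta_bumpE] brings it into the form y_s = y
    yb q. *)
Lemma is_derive_beta_transform (x : R) : x \in `]0, 1[ ->
  is_derive x 1 phi (phi x * (1 - phi x) * q x * (x * (1 - x))^-1).
Proof.
move=> x01; have p01 := beta_transform_oo x01.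
have [C_gt0 _ _ _ dF] := F_beta; have [C'_gt0 _ _ _ dG] := G_beta.
have [_ GpF] := beta_transformP (subset_itv_oo_cc x01).
have dGp := dG _ p01.
have dinv : is_derive (F x) 1 (pinv [set` `[(0 : R), 1]] G)
  (C' * beta_kernel a' b' (phi x))^-1.
  rewrite -GpF; apply: is_derive_inverse dGp _.
  - near=> t; rewrite pinvKV// inE; apply: subset_itv_oo_cc; near: t.
    exact: near_in_itvoo.
  - near=> t; have t01 : t \in `]0, 1[ by near: t; exact: near_in_itvoo.
    have [dGt _] := dG _ t01.
    by apply: differentiable_continuous; exact/derivable1_diffP.
  - by rewrite gt_eqF// mulr_gt0// beta_kernel_gt0.
apply: (@is_derive_eq _ _ _ _ _ _ _ _ (is_derive1_comp dinv (dF x x01))).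
have k'_gt0 := beta_kernel_gt0 a' b' p01.
move: (x01) (p01); rewrite !in_itv/= => /andP[x_gt0 x_lt1] /andP[p_gt0 p_lt1].
rewrite /q !beta_bumpE//.
by field; rewrite !gt_eqF ?subr_gt0.
Unshelve. all: by end_near. Qed.

Let q_gt0 (x : R) : x \in `]0, 1[ -> 0 < q x.
Proof.
move=> x01; rewrite divr_gt0//; first exact: beta_bump_gt0 F_beta _ _.
by apply: beta_bump_gt0 G_beta _ _; exact: beta_transform_oo.
Qed.

(** Logarithmic differentiation: the bump of F contributes a xb - b x, and that of G, composed with
    [phi], contributes (a' yb - b' y) q. *)
Let dq (x : R) : x \in `]0, 1[ -> is_derive x 1 q (q x *
  (a * (1 - x) - b * x - (a' * (1 - phi x) - b' * phi x) * q x) *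
    (x * (1 - x))^-1).
Proof.
move=> x01; have p01 := beta_transform_oo x01.
have h1 := is_derive_beta_bump C a_gt0 b_gt0 x01.
have h2 := is_derive1_comp (is_derive_beta_bump C' a'_gt0 b'_gt0 p01)
  (is_derive_beta_transform x01).
have H_gt0 := beta_bump_gt0 G_beta p01.
have H_neq0 : (beta_bump a' b' C' \o phi) x != 0 by rewrite gt_eqF.
have h3 := is_deriveV H_neq0 h2.
have k_gt0 := beta_kernel_gt0 a b x01.
have k'_gt0 := beta_kernel_gt0 a' b' p01.
have [C'_gt0 _ _ _ _] := G_beta.
have := @is_deriveM _ _ _ _ _ _ _ _ h1 h3 => h4.
apply: (is_derive_eq h4).
rewrite /GRing.scale/= /q !beta_bumpE//.
move: (x01) (p01); rewrite !in_itv/= => /andP[x_gt0 x_lt1] /andP[p_gt0 p_lt1].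
by field; rewrite !gt_eqF ?subr_gt0.
Qed.

(** As F x = G (phi x), q is the quotient of bump/F at x by bump/G at [phi x]. The latter has its
    limit along [phi] because [phi] tends to 0 through positive values. *)
Let q_cvg0 : q x @[x --> (0 : R)^'+] --> a / a'.
Proof.
have phi_right : phi x @[x --> (0 : R)^'+] --> (0 : R)^'+.
  move=> A [e /= e_gt0 Ae].
  suff : \forall x \near (0 : R)^'+, A (phi x) by [].
  near=> x; apply: Ae => /=.
    by near: x; move/cvgrPdist_lt: beta_transform_cvg0 => /(_ _ e_gt0).
  have : phi x \in `]0, 1[.
    by apply: beta_transform_oo; rewrite in_itv/=; apply/andP; split.
  by rewrite in_itv/= => /andP[].
have h1 := beta_bump_df_cvg0 a_gt0 b_gt0 F_beta.
have h2 := cvg_comp _ _ phi_right (beta_bump_df_cvg0 a'_gt0 b'_gt0 G_beta).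
have : beta_bump a b C x / F x *
    (beta_bump a' b' C' (phi x) / G (phi x))^-1 @[x --> (0 : R)^'+] --> a / a'.
  by apply: cvgM => //; apply: cvgV => //; rewrite gt_eqF.
apply: cvg_trans; apply: near_eq_cvg; near=> x.
have x01 : x \in `]0, 1[ by rewrite in_itv/=; apply/andP; split.
have [_ ->] := beta_transformP (subset_itv_oo_cc x01).
have /gt_eqF H_neq0 := beta_bump_gt0 G_beta (beta_transform_oo x01).
have := beta_df_itvoo F_beta x01; rewrite in_itv/= => /andP[/gt_eqF F_neq0 _].
by rewrite /q; field; rewrite H_neq0 F_neq0.
Unshelve. all: by end_near. Qed.

Let q_cvg1 : q x @[x --> (1 : R)^'-] --> b / b'.
Proof.
have phi_left : phi x @[x --> (1 : R)^'-] --> (1 : R)^'-.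
  move=> A [e /= e_gt0 Ae].
  suff : \forall x \near (1 : R)^'-, A (phi x) by [].
  near=> x; apply: Ae => /=.
    by near: x; move/cvgrPdist_lt: beta_transform_cvg1 => /(_ _ e_gt0).
  have : phi x \in `]0, 1[.
    by apply: beta_transform_oo; rewrite in_itv/=; apply/andP; split.
  by rewrite in_itv/= => /andP[].
have h1 := beta_bump_df_cvg1 a_gt0 b_gt0 F_beta.
have h2 := cvg_comp _ _ phi_left (beta_bump_df_cvg1 a'_gt0 b'_gt0 G_beta).
have : beta_bump a b C x / (1 - F x) *
    (beta_bump a' b' C' (phi x) / (1 - G (phi x)))^-1 @[x --> (1 : R)^'-] --> b
      / b'.
  by apply: cvgM => //; apply: cvgV => //; rewrite gt_eqF.
apply: cvg_trans; apply: near_eq_cvg; near=> x.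
have x01 : x \in `]0, 1[ by rewrite in_itv/=; apply/andP; split.
have [_ ->] := beta_transformP (subset_itv_oo_cc x01).
have /gt_eqF H_neq0 := beta_bump_gt0 G_beta (beta_transform_oo x01).
have := beta_df_itvoo F_beta x01.
rewrite in_itv/= -[_ < 1]subr_gt0 => /andP[_ /gt_eqF F_neq0].
by rewrite /q; field; rewrite H_neq0 F_neq0.
Unshelve. all: by end_near. Qed.

(** * Monotone likelihood ratio and comparison of F with G *)

Lemma beta_kernel_ratio (s t : R) : a' <= a -> b <= b' ->
  s \in `]0, 1[ -> t \in `]0, 1[ -> s <= t ->
  beta_kernel a b s * beta_kernel a' b' t <= beta_kernel a b t * beta_kernel a'
    b' s.
Proof.
move=> aa' bb' s01 t01 st.
(* Moving (1 - x) to the left-hand side makes both exponents b' - b and a - a' nonnegative, so that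
   these powers are monotone in their bases. *)
have split_kernel (x : R) : x \in `]0, 1[ ->
    beta_kernel a b x * (1 - x) `^ (b' - b) = beta_kernel a' b' x * x `^
      (a - a').
  rewrite in_itv/= => /andP[x_gt0 x_lt1].
  have x_neq0 : x != 0 by rewrite gt_eqF.
  have xc_neq0 : 1 - x != 0 by rewrite gt_eqF// subr_gt0.
  rewrite /beta_kernel -mulrA -powRD ?xc_neq0 ?implybT//.
  rewrite mulrAC -powRD ?x_neq0 ?implybT//.
  by congr (_ `^ _ * _ `^ _); ring.
have ks := split_kernel _ s01; have kt := split_kernel _ t01.
have k's_gt0 := beta_kernel_gt0 a' b' s01; have k't_gt0 :=
  beta_kernel_gt0 a' b' t01.
move: s01 t01; rewrite !in_itv/= => /andP[s_gt0 s_lt1] /andP[t_gt0 t_lt1].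
have sc_gt0 : 0 < (1 - s) `^ (b' - b) by rewrite powR_gt0// subr_gt0.
have tc_gt0 : 0 < (1 - t) `^ (b' - b) by rewrite powR_gt0// subr_gt0.
rewrite -(ler_pM2r sc_gt0) -(ler_pM2r tc_gt0).
rewrite [X in X * _ <= _]mulrAC ks.
rewrite [X in _ <= X]mulrAC [X in _ <= X * _]mulrAC kt.
set A := beta_kernel a' b' s; set B := beta_kernel a' b' t.
have -> : A * s `^ (a - a') * B * (1 - t) `^ (b' - b)
  = A * B * (s `^ (a - a') * (1 - t) `^ (b' - b)) by ring.
have -> : B * t `^ (a - a') * A * (1 - s) `^ (b' - b)
  = A * B * (t `^ (a - a') * (1 - s) `^ (b' - b)) by ring.
rewrite ler_pM2l; last exact: mulr_gt0.
apply: ler_pM; rewrite ?powR_ge0//.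
  by apply: ge0_ler_powR => //; rewrite ?subr_ge0// nnegrE ltW.
by apply: ge0_ler_powR; rewrite ?nnegrE ?lerD2l ?lerN2// subr_ge0// ltW.
Qed.

(** The ratio F'/G' is nondecreasing. If it is at most 1 at x, then G - F increases from 0 on
    [0, x]; otherwise it decreases to 0 on [x, 1]. *)
Lemma beta_df_anti (x : R) : a' <= a -> b <= b' -> x \in `]0, 1[ -> F x <= G x.
Proof.
move=> aa' bb' x01.
have [C_gt0 F0 F1 cF dF] := F_beta; have [C'_gt0 G0 G1 cG dG] := G_beta.
pose f (t : R) := C * beta_kernel a b t; pose g (t : R) :=
  C' * beta_kernel a' b' t.
have f_gt0 (t : R) : t \in `]0, 1[ -> 0 < f t by move=> t01;
  rewrite mulr_gt0// beta_kernel_gt0.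
have g_gt0 (t : R) : t \in `]0, 1[ -> 0 < g t by move=> t01;
  rewrite mulr_gt0// beta_kernel_gt0.
have fg (s t : R) : s \in `]0, 1[ -> t \in `]0, 1[ -> s <= t ->
  f s * g t <= f t * g s.
  by move=> s01 t01 st; rewrite /f /g mulrACA [X in _ <= X]mulrACA ler_pM2l
    ?mulr_gt0// beta_kernel_ratio.
have dGF (t : R) : t \in `]0, 1[ -> is_derive t 1 (fun t => G t - F t)
  (g t - f t).
  by move=> t01; have h1 := dF t t01; have h2 := dG t t01; exact: is_deriveB.
have cGF : {within `[0, 1], continuous (fun t => G t - F t)}.
  by move=> t; apply: cvgB; [exact: cG|exact: cF].
have xcc := subset_itv_oo_cc x01.
move: (x01); rewrite in_itv/= => /andP[x_gt0 x_lt1].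
have gf_cmp : (f x <= g x) || (g x <= f x) by exact: le_total.
rewrite -subr_ge0; case/orP: gf_cmp => fx.
- have sub (t : R) : t \in `]0, x[ -> t \in `]0, 1[.
    by rewrite !in_itv/= => /andP[-> /lt_trans ->].
  rewrite -[X in X <= _](subrr (0 : R)) -[X in X - _ <= _]G0 -[X in _ - X <=
    _]F0.
  apply: (@ger0_derive1_le_cc R (fun t => G t - F t) 0 x);
    rewrite ?in_itv/= ?lexx ?ltW//.
  + by move=> t /sub t01; have [] := dGF t t01.
  + move=> t t0x; have t01 := sub t t0x; have [_] := dGF t t01;
      rewrite derive1E => ->.
    rewrite subr_ge0 -(ler_pM2r (g_gt0 _ x01)) (le_trans (fg t x t01 x01 _))//.
      by move: t0x; rewrite in_itv/= => /andP[_ /ltW].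
    by rewrite mulrC ler_pM2l ?g_gt0.
  + by apply: continuous_subspaceW cGF; apply: subset_itvl;
      rewrite bnd_simp ltW.
- have sub (t : R) : t \in `]x, 1[ -> t \in `]0, 1[.
    by rewrite !in_itv/= => /andP[/(lt_trans x_gt0) -> ->].
  rewrite -[X in X <= _](subrr (1 : R)) -[X in X - _ <= _]G1 -[X in _ - X <=
    _]F1.
  apply: (@ler0_derive1_le_cc R (fun t => G t - F t) x 1);
    rewrite ?in_itv/= ?lexx ?ltW//.
  + by move=> t /sub t01; have [] := dGF t t01.
  + move=> t tx1; have t01 := sub t tx1; have [_] := dGF t t01;
      rewrite derive1E => ->.
    rewrite subr_le0 -(ler_pM2l (f_gt0 _ x01)) (le_trans (fg x t x01 t01 _))//.
      by move: tx1; rewrite in_itv/= => /andP[/ltW].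
    by rewrite mulrC ler_pM2r ?f_gt0.
  + by apply: continuous_subspaceW cGF; apply: subset_itvr;
      rewrite bnd_simp ltW.
Qed.

Lemma beta_transform_le (x : R) : a' <= a -> b <= b' -> x \in `]0, 1[ ->
  phi x <= x.
Proof.
move=> aa' bb' x01; have xcc := subset_itv_oo_cc x01.
have [pcc GpF] := beta_transformP xcc.
by rewrite -(beta_df_le G_beta)// GpF beta_df_anti.
Qed.

(** * Second derivative of the transform and its convexity *)

Let slope (x : R) : R := phi x * (1 - phi x) * q x * (x * (1 - x))^-1.

Let slope_ge0 (x : R) : x \in `]0, 1[ -> 0 <= slope x.
Proof.
move=> x01; have /itvP p01 := beta_transform_oo x01; move: (x01).
rewrite in_itv/= => /andP[x_gt0 x_lt1].
have q_ge0 := ltW (q_gt0 x01); have xc_ge0 : 0 <= 1 - x by rewrite subr_ge0 ltW.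
apply: mulr_ge0; last by rewrite invr_ge0 mulr_ge0// ltW.
by do 2 (apply: mulr_ge0 => //); rewrite ?subr_ge0 p01.
Qed.

(** The logarithmic s-derivative of y yb q / (x xb) is q yb - q y + tau - (xb - x), which is E. *)
Let dslope (x : R) : x \in `]0, 1[ -> is_derive x 1 slope
  (slope x * (x * (1 - x))^-1 *
  (a * (1 - x) - b * x - (a' * (1 - phi x) - b' * phi x) * q x +
   (q x * (1 - phi x) - (1 - x)) + (x - phi x * q x))).
Proof.
move=> x01; have h1 := is_derive_beta_transform x01; have h2 := dq x01.
move: (x01); rewrite in_itv/= => /andP[x_gt0 x_lt1].
have k_neq0 : x * (1 - x) != 0 by rewrite mulf_neq0// gt_eqF// subr_gt0.
have h3 : is_derive x 1 (fun t : R => t * (1 - t)) (1 - 2 * x).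
  by apply: is_derive_eq; rewrite /GRing.scale/=; ring.
have h4 := @is_deriveV _ (fun t : R => t * (1 - t)) x _ _ k_neq0 h3.
apply: is_derive_eq; rewrite /GRing.scale/= /slope.
by field; rewrite !gt_eqF ?subr_gt0.
Qed.

Lemma beta_transform_continuous : {within `[0, 1], continuous phi}.
Proof.
apply/(continuous_within_itvP _ ltr01); split.
- move=> x x01; have [dphi _] := is_derive_beta_transform x01.
  by apply: differentiable_continuous; exact/derivable1_diffP.
- by rewrite beta_transform0; exact: beta_transform_cvg0.
- by rewrite beta_transform1; exact: beta_transform_cvg1.
Qed.

Lemma beta_transform_convex : a' <= a -> b <= b' ->
  convex_function [set` `[(0 : R), 1]] phi.
Proof.
move=> aa' bb'.
have phi01 (x : R) : x \in `]0, 1[ -> 0 < phi x < 1.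
  by move=> /beta_transform_oo; rewrite in_itv.
have phi_le (x : R) : x \in `]0, 1[ -> phi x <= x.
  exact: beta_transform_le.
(* The points u and v may be 0 and 1, so only continuity is used at them and the second derivative
   only strictly between them. *)
have conv_lt (u v : R) (t : {i01 R}) : 0 <= u -> u < v -> v <= 1 ->
    phi (conv t (u : R^o) (v : R^o)) <= conv t (phi u : R^o) (phi v : R^o).
  move=> u_ge0 uv v_le1.
  have sub (x : R) : x \in `]u, v[ -> x \in `]0, 1[.
    rewrite !in_itv/= => /andP[/(le_lt_trans u_ge0) -> xv].
    exact: lt_le_trans v_le1.
  have cphi : {within `[u, v], continuous phi}.
    by apply: continuous_subspaceW beta_transform_continuous;
      exact: subset_itvScc.
  have [_ cu cv] := (continuous_within_itvP _ uv).1 cphi.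
  have dDphi (x : R) : x \in `]u, v[ -> is_derive x 1 ('D_1 phi)
    (slope x * (x * (1 - x))^-1 *
      (a * (1 - x) - b * x - (a' * (1 - phi x) - b' * phi x) * q x +
      (q x * (1 - phi x) - (1 - x)) + (x - phi x * q x))).
    move=> xuv; apply: near_eq_is_derive (dslope (sub _ xuv)).
    near=> z; have zuv : z \in `]u, v[ by near: z; exact: near_in_itvoo.
    by have [_ ->] := is_derive_beta_transform (sub _ zuv).
  apply: second_derivative_convex (ltW uv) => //.
  - move=> x /andP[ux xv]; have xuv : x \in `]u, v[ by rewrite in_itv/= ux xv.
    have x01 := sub _ xuv; have [_ ->] := dDphi _ xuv.
    rewrite mulr_ge0//.
      rewrite mulr_ge0 ?slope_ge0// invr_ge0; move: x01.
      by rewrite in_itv/= => /andP[? ?]; rewrite mulr_ge0// ?subr_ge0 ltW.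
    exact: (relative_convexity_ge0 a'_gt0 b_gt0 aa' bb' phi01 phi_le q_gt0
      is_derive_beta_transform dq beta_transform_cvg0 beta_transform_cvg1
      q_cvg0 q_cvg1 x01).
  - by move=> x xuv; have [] := is_derive_beta_transform (sub _ xuv).
  - by move=> x xuv; have [] := dDphi _ xuv.
move=> t u v; rewrite !inE/= !in_itv/= => /andP[u_ge0 u_le1] /andP[v_ge0 v_le1].
have [uv|vu|->] := ltgtP u v; last by rewrite !convmm.
- exact: conv_lt.
- by rewrite convC [leRHS]convC; exact: conv_lt.
Unshelve. all: by end_near. Qed.

(** The tangent at x is compared with the graph at 0 and at 1, and x then tends to that same
    endpoint. *)
Lemma beta_transform_convex_params : convex_function [set` `[(0 : R), 1]] phi ->
  a' <= a /\ b <= b'.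
Proof.
move=> conv_phi; split.
- suff : 0 <= a / a' * (1 - 0) - (1 - 0).
    by rewrite !subr0 mulr1 subr_ge0 ler_pdivlMr// mul1r.
  have h : q x * (1 - phi x) - (1 - x) @[x --> (0 : R)^'+] --> a / a' * (1 - 0)
    - (1 - 0).
    apply: cvgB; last by apply: cvgB; [exact: cvg_cst|apply:
      cvg_at_right_filter; exact: cvg_id].
    by apply: cvgM q_cvg0 _; apply: cvgB beta_transform_cvg0; exact: cvg_cst.
  apply: cvgr_to_ge h _; near=> x.
  have x01 : x \in `]0, 1[ by rewrite in_itv/=; apply/andP; split.
  have D0 : [set` `[(0 : R), 1]] 0 by rewrite /= in_itv/= lexx ler01.
  have := convex_function_tangent conv_phi (subset_itv_oo_cc x01) D0
    (is_derive_beta_transform x01).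
  have /itvP p01 := beta_transform_oo x01; move: (x01);
    rewrite in_itv/= => /andP[x_gt0 x_lt1].
  rewrite beta_transform0 subr_ge0.
  (* The tangent's value at 0 is a positive multiple of xb - q yb, so its being at most 0 means q yb
     >= xb. *)
  have -> : phi x + phi x * (1 - phi x) * q x / (x * (1 - x)) * (0 - x) =
     phi x / (1 - x) * (1 - x - q x * (1 - phi x)).
    by field; rewrite !gt_eqF ?subr_gt0.
  by rewrite pmulr_rle0 ?subr_le0// divr_gt0 ?subr_gt0// p01.
- suff : 0 <= 1 - 1 * (b / b').
    by rewrite mul1r subr_ge0 ler_pdivrMr// mul1r.
  have h : x - phi x * q x @[x --> (1 : R)^'-] --> 1 - 1 * (b / b').
    apply: cvgB; first by apply: cvg_at_left_filter; exact: cvg_id.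
    exact: cvgM beta_transform_cvg1 q_cvg1.
  apply: cvgr_to_ge h _; near=> x.
  have x01 : x \in `]0, 1[ by rewrite in_itv/=; apply/andP; split.
  have D1 : [set` `[(0 : R), 1]] 1 by rewrite /= in_itv/= lexx ler01.
  have := convex_function_tangent conv_phi (subset_itv_oo_cc x01) D1
    (is_derive_beta_transform x01).
  have /itvP p01 := beta_transform_oo x01; move: (x01);
    rewrite in_itv/= => /andP[x_gt0 x_lt1].
  rewrite beta_transform1 -subr_ge0.
  (* The gap between 1 and the tangent's value at 1 is a positive multiple of x - q y. *)
  have -> : 1 - (phi x + phi x * (1 - phi x) * q x / (x * (1 - x)) * (1 - x)) =
     (1 - phi x) / x * (x - phi x * q x).
    by field; rewrite !gt_eqF ?subr_gt0.
  by rewrite pmulr_rge0// divr_gt0 ?subr_gt0// p01.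
Unshelve. all: by end_near. Qed.

End beta_transform.

(** * From beta distributed variables to their distribution functions *)

Section beta_distribution.
Variables (R : realType) (d : measure_display) (T : measurableType d).
Variables (P : probability T R) (X : {RV P >-> R}) (a b : R).
Hypothesis X_beta : beta_distributed X a b.

Notation mu := (@lebesgue_measure R).
Let f : R -> R := beta_density a b.

Let f_ge0 (x : R) : 0 <= f x.
Proof.
rewrite /f /beta_density patchE; case: ifPn => // _.
rewrite divr_ge0 ?mulr_ge0 ?powR_ge0//.
by apply: Rintegral_ge0 => y _; rewrite mulr_ge0 ?powR_ge0.
Qed.

Let f_eq0 (x : R) : x \notin `]0, 1[ -> f x = 0.
Proof. by move=> x01; rewrite /f /beta_density patchE mem_setE (negbTE x01).
  Qed.

Let measurable_f : measurable_fun setT f.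
Proof.
apply/(measurable_restrictT _ _).1 => //.
apply: measurable_funTS; apply: measurable_funM => //.
apply: measurable_funM; first exact: measurable_powR.
apply: (measurableT_comp (measurable_powR _)) => //.
exact: measurable_funB.
Qed.

Lemma beta_distributed_itv (A : set R) : measurable A ->
  [set` `]0, 1[] `<=` A -> distribution P X A = 1%E.
Proof.
move=> mA sub01; rewrite -(probability_setT (distribution P X)) X_beta//
  [RHS]X_beta//.
rewrite integral_mkcond; apply: eq_integral => x _.
rewrite patchE; case: ifPn => //; rewrite notin_setE => nAx.
by rewrite -/f f_eq0//; apply/negP => x01; apply: nAx; exact: sub01.
Qed.

Let integral_f : (\int[mu]_x (f x)%:E = 1)%E.
Proof. by rewrite -X_beta// beta_distributed_itv. Qed.

Let integrable_f (A : set R) : measurable A -> mu.-integrable A (EFin \o f).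
Proof.
move=> mA; apply: (@integrableS _ _ _ mu setT) => //.
apply/integrableP; split; first exact/measurable_EFinP.
under eq_integral do rewrite /= ger0_norm//.
by rewrite integral_f ltry.
Qed.

(** Positivity follows from the total mass 1: if the integral had the value 0, the convention 0^-1 =
    0 would make the density vanish identically. *)
Let beta_integral_gt0 : 0 < beta_integral a b.
Proof.
rewrite lt_neqAle; apply/andP; split; last first.
  by apply: Rintegral_ge0 => y _; rewrite mulr_ge0 ?powR_ge0.
apply/eqP => B0; have := integral_f; rewrite integral0_eq.
  by move/eqP; rewrite eq_sym onee_eq0.
move=> x _; rewrite /f /beta_density patchE; case: ifPn => // _.
by rewrite -B0 invr0 mulr0.
Qed.

(** The density vanishes on negative numbers, so integration may start at 0; continuity on [0, 1] is
    then that of a parameterized integral. *)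
Let dfE : df X = fun x => parameterized_integral mu 0 x f.
Proof.
apply/funext => x; rewrite /df /cdf X_beta// /parameterized_integral /Rintegral.
congr fine; rewrite [LHS]integral_mkcond [RHS]integral_mkcond.
apply: eq_integral => t _; rewrite !patchE !mem_setE !in_itv/=.
have [t_ge0|t_lt0] := leP 0 t; first by [].
by rewrite -/f f_eq0 ?if_same// in_itv/= ltNge (ltW t_lt0).
Qed.

Lemma is_beta_df_df : is_beta_df a b (beta_integral a b)^-1 (df X).
Proof.
have df_FTC (x : R) : df X x = \int[mu]_(t in [set` `]-oo, x]]) f t.
  by rewrite /df /cdf X_beta.
split.
- by rewrite invr_gt0.
- by rewrite dfE /parameterized_integral set_itv1 Rintegral_set1.
- rewrite /df /cdf beta_distributed_itv// => x /=.
  by rewrite !in_itv/= => /andP[_ /ltW].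
- rewrite dfE; apply: parameterized_integral_continuous => //.
  exact: integrable_f.
- move=> x x01; have /itvP x01' := x01.
  have x_gt0 : 0 < x by rewrite x01'.
  have x_lt1 : x < 1 by rewrite x01'.
  have fE (t : R) : t \in `]0, 1[ -> f t = (beta_integral a b)^-1 * beta_kernel
    a b t.
    by move=> t01; rewrite /f /beta_density patchE mem_setE t01 mulrC.
  (* Near x the density coincides with a differentiable product of powers, which gives the
     continuity that the fundamental theorem of calculus asks for. *)
  have cf : {for x, continuous f}.
    have h1 := is_derive1_powR (a - 1) x_gt0.
    have h2 := is_derive_onem_powR (b - 1) x_lt1.
    have [dk _] := is_deriveZ (beta_integral a b)^-1 (is_deriveM h1 h2).
    have : (beta_integral a b)^-1 * beta_kernel a b t @[t --> x] --> f x.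
      suff : {for x, continuous
        (fun t => (beta_integral a b)^-1 * beta_kernel a b t)}.
        by rewrite fE.
      by apply: differentiable_continuous; exact/derivable1_diffP.
    apply: cvg_trans; apply: near_eq_cvg.
    by near=> t; rewrite fE//; near: t; exact: near_in_itvoo.
  have [] := @continuous_FTC1 R f -oo%O x 1 _ _ _ cf.
  + by rewrite x01'.
  + exact: integrable_f.
  + by rewrite ltNyr.
  rewrite derive1E => dF Fx; rewrite -(fE x x01).
  suff -> : df X = fun x => \int[mu]_(t in [set` `]-oo, x]]) f t by [].
  exact/funext.
Unshelve. all: by end_near. Qed.

End beta_distribution.

Theorem theorem3 (R : realType) (a b a' b' : R)
    (a_gt0 : 0 < a) (b_gt0 : 0 < b) (a'_gt0 : 0 < a') (b'_gt0 : 0 < b')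
    (d d' : measure_display) (T : measurableType d) (T' : measurableType d')
    (P : probability T R) (Q : probability T' R)
    (X : {RV P >-> R}) (Y : {RV Q >-> R})
    (X_beta : beta_distributed X a b) (Y_beta : beta_distributed Y a' b') :
  convex_transform_le X Y `[0, 1] `[0, 1] <-> (a' <= a /\ b <= b').
Proof.
have F_beta := is_beta_df_df X_beta; have G_beta := is_beta_df_df Y_beta.
split=> [[_ _ _ conv]|[aa' bb']].
  exact: beta_transform_convex_params F_beta G_beta conv.
split.
- split; last exact: beta_df_lt F_beta.
  by apply: (beta_distributed_itv X_beta) => //; exact: subset_itv_oo_cc.
- split; last exact: beta_df_lt G_beta.
  by apply: (beta_distributed_itv Y_beta) => //; exact: subset_itv_oo_cc.
- move=> _ [x x01 <-]; have [y01 GyFx] := beta_transformP F_beta G_beta x01.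
  by exists (pinv [set` `[(0 : R), 1]] (df Y) (df X x)).
- exact: beta_transform_convex F_beta G_beta aa' bb'.
Qed.
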